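(* Let $\mathbb{H}_{\mathbb{Z}_2}(-1,-1)$ be the quaternion algebra over $\mathbb{Z}_2=\mathbb{Z}/2\mathbb{Z}$, and for $n\ge 0$ let $F_n=f_n+f_{n+1}i+f_{n+2}j+f_{n+3}k$ be the $n$-th Fibonacci quaternion, regarded as an element of $\mathbb{H}_{\mathbb{Z}_2}(-1,-1)$. Then: (i) for every $n\ge 0$, $F_n$ is a zero divisor in $\mathbb{H}_{\mathbb{Z}_2}(-1,-1)$ if and only if $n\equiv 0 \pmod 3$; (ii) among the distinct elements of $\{F_n : n\ge 0\}\subset \mathbb{H}_{\mathbb{Z}_2}(-1,-1)$, exactly one is a zero divisor and exactly two are invertible.
   Context: $(f_n)_{n\ge 0}$ is the Fibonacci sequence: $f_0=0$, $f_1=1$, $f_n=f_{n-1}+f_{n-2}$ for $n\ge 2$. For a prime $p$, $\mathbb{Z}_p=\mathbb{Z}/p\mathbb{Z}$ and $\mathbb{H}_{\mathbb{Z}_p}(-1,-1)$ is the 4-dimensional associative unital $\mathbb{Z}_p$-algebra with basis $\{1,i,j,k\}$ and relations $i^2=j^2=-1$, $k=ij=-ji$. Integer coefficients are reduced modulo $p$. An element $x$ of a ring is a zero divisor if there is a nonzero $y$ with $xy=0$ or $yx=0$ (so $0$ counts as a zero divisor). *)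

(* Defs.v *)
From HB Require Import structures.
From mathcomp Require Import all_boot all_order all_algebra.
From mathcomp Require Import ring.
From mathcomp Require Import boolp classical_sets functions cardinality.

Set Implicit Arguments.
Unset Strict Implicit.
Unset Printing Implicit Defensive.

Import GRing.Theory.
Local Open Scope ring_scope.

(* The quaternion algebra H_R(a, b), with i^2 = a, j^2 = b, k = ij = -ji.
   [Quat x y z t] is x + y i + z j + t k. *)
Record quat (R : Type) (a b : R) : Type :=
  Quat { qre : R; qim_i : R; qim_j : R; qim_k : R }.

Arguments Quat {R a b} _ _ _ _.

Section QuatEncoding.
Variables (R : Type) (a b : R).

Definition quat_to_prod (x : quat a b) := (qre x, qim_i x, qim_j x, qim_k x).
Definition prod_to_quat (t : R * R * R * R) : quat a b :=
  let: (x, y, z, t) := t in Quat x y z t.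

Lemma quat_to_prodK : cancel quat_to_prod prod_to_quat.
Proof. by case. Qed.
End QuatEncoding.

HB.instance Definition _ (R : eqType) (a b : R) :=
  Equality.copy (quat a b) (can_type (@quat_to_prodK R a b)).
HB.instance Definition _ (R : choiceType) (a b : R) :=
  Choice.copy (quat a b) (can_type (@quat_to_prodK R a b)).
HB.instance Definition _ (R : countType) (a b : R) :=
  Countable.copy (quat a b) (can_type (@quat_to_prodK R a b)).
HB.instance Definition _ (R : finType) (a b : R) :=
  Finite.copy (quat a b) (can_type (@quat_to_prodK R a b)).

Section QuatAlgebra.
Variables (R : comNzRingType) (a b : R).
Local Notation H := (quat a b).

Definition quat0 : H := Quat 0 0 0 0.
Definition quat1 : H := Quat 1 0 0 0.
Definition qi : H := Quat 0 1 0 0.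
Definition qj : H := Quat 0 0 1 0.
Definition qk : H := Quat 0 0 0 1.

Definition quat_opp (u : H) : H :=
  let: Quat x y z t := u in Quat (- x) (- y) (- z) (- t).

Definition quat_add (u v : H) : H :=
  let: Quat x y z t := u in let: Quat x' y' z' t' := v in
  Quat (x + x') (y + y') (z + z') (t + t').

Definition quat_scale (c : R) (u : H) : H :=
  let: Quat x y z t := u in Quat (c * x) (c * y) (c * z) (c * t).

(* Bilinear extension of i^2 = a, j^2 = b, k^2 = -ab, ij = -ji = k,
   jk = -kj = -b i, ki = -ik = -a j. *)
Definition quat_mul (u v : H) : H :=
  let: Quat x y z t := u in let: Quat x' y' z' t' := v in
  Quat (x * x' + a * (y * y') + b * (z * z') - a * b * (t * t'))
       (x * y' + y * x' - b * (z * t') + b * (t * z'))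
       (x * z' + z * x' + a * (y * t') - a * (t * y'))
       (x * t' + t * x' + y * z' - z * y').

Fact quat_addA : associative quat_add.
Proof. by case=> ? ? ? ? [? ? ? ?] [? ? ? ?]; congr Quat; rewrite addrA. Qed.
Fact quat_addC : commutative quat_add.
Proof. by case=> ? ? ? ? [? ? ? ?]; congr Quat; rewrite addrC. Qed.
Fact quat_add0 : left_id quat0 quat_add.
Proof. by case=> ? ? ? ?; congr Quat; rewrite add0r. Qed.
Fact quat_addN : left_inverse quat0 quat_opp quat_add.
Proof. by case=> ? ? ? ?; congr Quat; rewrite addNr. Qed.

HB.instance Definition _ :=
  GRing.isZmodule.Build H quat_addA quat_addC quat_add0 quat_addN.

Fact quat_mulA : associative quat_mul.
Proof. by case=> ? ? ? ? [? ? ? ?] [? ? ? ?]; congr Quat; ring. Qed.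
Fact quat_mul1l : left_id quat1 quat_mul.
Proof. by case=> ? ? ? ?; congr Quat; ring. Qed.
Fact quat_mul1r : right_id quat1 quat_mul.
Proof. by case=> ? ? ? ?; congr Quat; ring. Qed.
Fact quat_mulDl : left_distributive quat_mul quat_add.
Proof. by case=> ? ? ? ? [? ? ? ?] [? ? ? ?]; congr Quat; ring. Qed.
Fact quat_mulDr : right_distributive quat_mul quat_add.
Proof. by case=> ? ? ? ? [? ? ? ?] [? ? ? ?]; congr Quat; ring. Qed.
Fact quat1_neq0 : quat1 != quat0.
Proof. by apply/eqP => -[/eqP]; rewrite oner_eq0. Qed.

HB.instance Definition _ :=
  GRing.Zmodule_isNzRing.Build H
    quat_mulA quat_mul1l quat_mul1r quat_mulDl quat_mulDr quat1_neq0.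

Fact quat_scaleA c d u : quat_scale c (quat_scale d u) = quat_scale (c * d) u.
Proof. by case: u => ? ? ? ?; congr Quat; rewrite mulrA. Qed.
Fact quat_scale1 : left_id 1 quat_scale.
Proof. by case=> ? ? ? ?; congr Quat; rewrite mul1r. Qed.
Fact quat_scaleDr : right_distributive quat_scale +%R.
Proof. by move=> c [? ? ? ?] [? ? ? ?]; congr Quat; rewrite mulrDr. Qed.
Fact quat_scaleDl u : {morph quat_scale^~ u : c d / c + d}.
Proof. by case: u => ? ? ? ? c d; congr Quat; rewrite mulrDl. Qed.

HB.instance Definition _ :=
  GRing.Zmodule_isLmodule.Build R H
    quat_scaleA quat_scale1 quat_scaleDr quat_scaleDl.

Fact quat_scaleAl c (u v : H) : c *: (u * v) = (c *: u) * v.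
Proof. by case: u v => ? ? ? ? [? ? ? ?]; congr Quat; ring. Qed.
HB.instance Definition _ := GRing.Lmodule_isLalgebra.Build R H quat_scaleAl.

Fact quat_scaleAr c (u v : H) : c *: (u * v) = u * (c *: v).
Proof. by case: u v => ? ? ? ? [? ? ? ?]; congr Quat; ring. Qed.
HB.instance Definition _ := GRing.Lalgebra_isAlgebra.Build R H quat_scaleAr.

Lemma qi_sqr : qi ^+ 2 = a%:A.
Proof. by congr Quat; ring. Qed.
Lemma qj_sqr : qj ^+ 2 = b%:A.
Proof. by congr Quat; ring. Qed.
Lemma qi_mul_qj : qi * qj = qk.
Proof. by congr Quat; ring. Qed.
Lemma qj_mul_qi : qj * qi = - qk.
Proof. by congr Quat; ring. Qed.

Lemma quat_basisE (x y z t : R) :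
  x%:A + y *: qi + z *: qj + t *: qk = Quat x y z t.
Proof. by congr Quat; ring. Qed.
End QuatAlgebra.

Arguments qi {R a b}.
Arguments qj {R a b}.
Arguments qk {R a b}.

(* Over a finite ring, the units of the algebra are its two-sided invertible
   elements, found by exhaustive search. *)
HB.instance Definition _ (R : finComNzRingType) (a b : R) :=
  FinRing.isNzRing.Build (quat a b).

Definition zero_divisor (A : pzRingType) (x : A) : Prop :=
  exists2 y : A, y != 0 & x * y = 0 \/ y * x = 0.

Fixpoint fib (n : nat) : nat :=
  if n is n1.+1 then
    if n1 is n2.+1 then (fib n1 + fib n2)%N else 1%N
  else 0%N.

Definition fib_quat (R : comNzRingType) (n : nat) : quat (-1 : R) (-1) :=
  (fib n)%:R%:A + (fib n.+1)%:R *: qi + (fib n.+2)%:R *: qj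
    + (fib n.+3)%:R *: qk.

(* Main.v *)
Require Import Defs.
From HB Require Import structures.
From mathcomp Require Import all_boot all_order all_algebra.
From mathcomp Require Import boolp classical_sets functions cardinality.
From mathcomp Require Import ring.

(** Modulo 2 the Fibonacci sequence has period 3, [0, 1, 1, 0, 1, 1, ...], so
    [F n] depends only on [n %% 3] and takes the three values [F 0], [F 1] and
    [F 2].  In characteristic 2 the basis elements [i], [j], [k] commute and
    square to [1], so squaring is additive and sends a quaternion to the scalar which is
    the square of the sum of its coordinates ([quat_sqr_pchar2]).  By the
    Fibonacci recurrence the coordinates of [F n] add up to
    [2 f_(n+2) + f_(n+3)], that is to [f_n] modulo 2; hence [F n ^+ 2 = f_n]
    ([fib_quat_F2_sqr]).  If [3] divides [n] this square is [0], and [F n],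
    being nonzero, is a zero divisor; otherwise the square is [1], and [F n] is
    its own inverse, which rules out being a zero divisor.  Thus [F 0] is the
    only zero divisor among the values, and [F 1], [F 2] are the units. *)

Set Implicit Arguments.
Unset Strict Implicit.
Unset Printing Implicit Defensive.

Import GRing.Theory.
Local Open Scope classical_set_scope.
Local Open Scope card_scope.
Local Open Scope ring_scope.

Lemma unit_not_zero_divisor (A : unitRingType) (x : A) :
  x \is a GRing.unit -> ~ zero_divisor x.
Proof.
move=> Ux [y /eqP y0 [xy0|yx0]]; apply: y0.
  by apply: (mulrI Ux); rewrite xy0 mulr0.
by apply: (mulIr Ux); rewrite yx0 mul0r.
Qed.

(** The mixed terms of the square cancel or occur twice, and the signs of
    [i ^+ 2 = j ^+ 2 = k ^+ 2 = -1] disappear in characteristic 2. *)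
Lemma quat_sqr_pchar2 (R : comNzRingType) (x y z t : R) :
  2 \in [pchar R] ->
  (Quat x y z t : quat (-1 : R) (-1)) ^+ 2 = ((x + y + z + t) ^+ 2)%:A.
Proof.
move=> R2; have double0 (u : R) : u * 2%:R = 0.
  by rewrite (pcharf0 R2) mulr0.
rewrite expr2 [LHS]/GRing.mul /= [RHS]/GRing.scale /=; congr Quat.
- (* Up to sign, the two sides differ by twice the sum of [y ^+ 2], [z ^+ 2],
     [t ^+ 2] and of the products of two distinct coordinates. *)
  apply/eqP; rewrite -subr_eq0; apply/eqP.
  rewrite -[RHS](double0 (- (y ^+ 2 + z ^+ 2 + t ^+ 2
     + x * y + x * z + x * t + y * z + y * t + z * t))).
  by ring.
- by rewrite mulr0 -[RHS](double0 (x * y)); ring.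
- by rewrite mulr0 -[RHS](double0 (x * z)); ring.
- by rewrite mulr0 -[RHS](double0 (x * t)); ring.
Qed.

Lemma pchar_F2 : 2 \in [pchar 'F_2].
Proof. exact: pchar_Fp. Qed.

Lemma fibSS n : fib n.+2 = (fib n.+1 + fib n)%N.
Proof. by []. Qed.

Lemma fib_F2_period n : (fib n.+3)%:R = (fib n)%:R :> 'F_2.
Proof.
by rewrite !fibSS addnAC addnn natrD -muln2 natrM (pcharf0 pchar_F2) mulr0 add0r.
Qed.

Lemma fib_F2_mod3 n : (fib n)%:R = ((n %% 3)%N != 0%N)%:R :> 'F_2.
Proof.
have [m] := ubnP n; elim: m n => // m IHm [|[|[|n]]] // ltnm.
rewrite fib_F2_period IHm; last exact/ltnW/ltnW.
by rewrite -[n.+3]addn3 modnDr.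
Qed.

Lemma fib_quatE (R : comNzRingType) n :
  fib_quat R n =
    Quat (fib n)%:R (fib n.+1)%:R (fib n.+2)%:R (fib n.+3)%:R.
Proof. exact: quat_basisE. Qed.

(** All four coordinates of [F n] repeat with period 3: this is what makes the
    range of [F] finite. *)
Lemma fib_quat_F2_mod3 n : fib_quat 'F_2 n = fib_quat 'F_2 (n %% 3)%N.
Proof.
have shift k : (fib (k + n)%N)%:R = (fib (k + n %% 3)%N)%:R :> 'F_2.
  by rewrite !fib_F2_mod3 modnDmr.
rewrite !fib_quatE; congr Quat.
- exact: (shift 0%N).
- exact: (shift 1%N).
- exact: (shift 2%N).
- exact: (shift 3%N).
Qed.

Lemma fib_quat_F2_neq0 n : fib_quat 'F_2 n != 0.
Proof.
rewrite fib_quat_F2_mod3 fib_quatE.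
by case: (n %% 3)%N (ltn_pmod n (isT : 0 < 3)%N) => [|[|[|]]].
Qed.

(** The parity of [f_n] decides between the two cases of the theorem: the
    square of [F n] is either [0] or [1]. *)
Lemma fib_quat_F2_sqr n : fib_quat 'F_2 n ^+ 2 = (fib n)%:R%:A.
Proof.
rewrite fib_quatE (quat_sqr_pchar2 _ _ _ _ pchar_F2) -!natrD.
(* [f_n + f_(n+1) + f_(n+2) + f_(n+3)] is congruent to [f_(n+3)], hence to
   [f_n], modulo 2. *)
rewrite [(fib n + _)%N]addnC -fibSS addnn natrD -muln2 natrM.
rewrite (pcharf0 pchar_F2) mulr0 add0r fib_F2_period fib_F2_mod3.
(* [0] and [1] are their own squares. *)
by case: (_ != _); rewrite ?expr1n ?expr0n.
Qed.

Lemma fib_quat_F2_zero_divisor n : (n %% 3)%N = 0%N ->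
  zero_divisor (fib_quat 'F_2 n).
Proof.
move=> n0; exists (fib_quat 'F_2 n); first exact: fib_quat_F2_neq0.
by left; rewrite -expr2 fib_quat_F2_sqr fib_F2_mod3 n0 scale0r.
Qed.

Lemma fib_quat_F2_unit n : (n %% 3)%N != 0%N ->
  fib_quat 'F_2 n \is a GRing.unit.
Proof.
move=> n0; have FF : fib_quat 'F_2 n * fib_quat 'F_2 n = 1.
  by rewrite -expr2 fib_quat_F2_sqr fib_F2_mod3 n0 scale1r.
by apply/unitrP; exists (fib_quat 'F_2 n).
Qed.

Theorem proposition2p1 :
  let F : nat -> quat (-1 : 'F_2) (-1) := fib_quat 'F_2 in
  [/\ forall n : nat, zero_divisor (F n) <-> (n = 0 %[mod 3])%N,
      range F `&` [set x | zero_divisor x] #= `I_1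
    & range F `&` [set x | x \is a GRing.unit] #= `I_2].
Proof.
move=> F.
have zdP n : zero_divisor (F n) <-> (n %% 3)%N = 0%N.
  split=> [zdF|]; last exact: fib_quat_F2_zero_divisor.
  by apply/eqP/negPn/negP => /fib_quat_F2_unit/unit_not_zero_divisor.
have unitP n : F n \is a GRing.unit <-> (n %% 3)%N != 0%N.
  split=> [UF|]; last exact: fib_quat_F2_unit.
  by apply/eqP => /zdP; apply: unit_not_zero_divisor.
split=> [n||]; first by rewrite mod0n; exact: zdP.
- suff -> : range F `&` [set x | zero_divisor x] = [set F 0%N].
    by rewrite card_set1.
  apply/seteqP; split=> [_ [[n _ <-] /zdP n0]|_ ->] /=.
    by rewrite /F fib_quat_F2_mod3 n0.
  by split; [exists 0%N | apply/zdP].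
- suff -> : range F `&` [set x | x \is a GRing.unit] =
      (fun k => F k.+1) @` `I_2.
    apply: inj_card_eq => k l /set_mem kI /set_mem lI; rewrite /F !fib_quatE.
    by case: k l kI lI => [|[|k]] [|[|l]].
  apply/seteqP; split=> [_ [[n _ <-] /unitP]|_ [k k2 <-]] /=.
  + rewrite /F fib_quat_F2_mod3.
    by case: (n %% 3)%N (ltn_pmod n (isT : 0 < 3)%N) => [|[|[|]]] // _ _;
      [exists 0%N | exists 1%N].
  + by split; [exists k.+1 | apply/unitP; case: k k2 => [|[|]]].
Qed.
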